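(* For every parameter vector $\bm{\theta}\in\mathbb{R}^D$, the gradient of the trace of the loss Hessian with respect to the hidden-to-output parameters $\bm{v}$ is $$\frac{\partial\,\mathrm{tr}(\bm{H}_L(\bm{\theta}))}{\partial\bm{v}}=\sum_{i=1}^I\big(\bm{\mathcal{V}}_i^{\mathrm{I}}+\bm{\mathcal{V}}_i^{\mathrm{II}}+\bm{\mathcal{V}}_i^{\mathrm{III}}\big)\in\mathbb{R}^{N+1},$$ where $\bm{\mathcal{V}}_i^{\mathrm{I}},\bm{\mathcal{V}}_i^{\mathrm{II}},\bm{\mathcal{V}}_i^{\mathrm{III}}\in\mathbb{R}^{N+1}$ are $$\bm{\mathcal{V}}_i^{\mathrm{I}}=(1+\bm{x}_i^\top\bm{x}_i)\Big(s''(z_i)\bm{h}(\bm{f}(\bm{y}_i))\widetilde{\bm{V}}\bm{F}'(\bm{y}_i)+2s'(z_i)\bm{F}'_0(\bm{y}_i)\Big)\bm{F}'(\bm{y}_i)\widetilde{\bm{V}}^\top,$$ $$\bm{\mathcal{V}}_i^{\mathrm{II}}=(1+\bm{x}_i^\top\bm{x}_i)\Big(s'(z_i)\bm{h}(\bm{f}(\bm{y}_i))\widetilde{\bm{V}}\bm{f}''(\bm{y}_i)+\delta_i\bm{f}''_0(\bm{y}_i)\Big),$$ $$\bm{\mathcal{V}}_i^{\mathrm{III}}=s''(z_i)\big(1+\bm{f}(\bm{y}_i)^\top\bm{f}(\bm{y}_i)\big)\bm{h}(\bm{f}(\bm{y}_i)).$$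
   Context: Network. Let $M,N,I\ge 1$ be integers and $f:\mathbb{R}\to\mathbb{R}$ a three times differentiable activation function with derivatives $f',f'',f'''$. For $\bm{y}\in\mathbb{R}^N$: $\bm{f}(\bm{y})=[f(y_1),\dots,f(y_N)]^\top$, and $\bm{f}',\bm{f}''$ are defined entrywise in the same way; $\bm{F}'(\bm{y})=\mathrm{diag}(\bm{f}'(\bm{y}))\in\mathbb{R}^{N\times N}$; $\bm{f}''_0(\bm{y})\in\mathbb{R}^{N+1}$ is $\bm{f}''(\bm{y})$ with an entry $0$ prepended; $\bm{F}'_0(\bm{y})\in\mathbb{R}^{(N+1)\times N}$ is $\bm{F}'(\bm{y})$ with a zero row prepended on top. For a vector $\bm{u}$, $\bm{h}(\bm{u})=[1\ \ \bm{u}^\top]^\top$. Parameters: $\bm{W}=[\bm{b}\ \ \widetilde{\bm{W}}]\in\mathbb{R}^{N\times(M+1)}$ with $\bm{b}\in\mathbb{R}^N$, $\widetilde{\bm{W}}\in\mathbb{R}^{N\times M}$, and $\bm{V}=[c\ \ \widetilde{\bm{V}}]\in\mathbb{R}^{1\times(N+1)}$ with $c\in\mathbb{R}$, $\widetilde{\bm{V}}\in\mathbb{R}^{1\times N}$. Let $\bm{w}\in\mathbb{R}^{(M+1)N}$ be the vertical concatenation of the columns of $\bm{W}$ (in order), $\bm{v}=\bm{V}^\top\in\mathbb{R}^{N+1}$, and $\bm{\theta}=[\bm{w}^\top\ \bm{v}^\top]^\top\in\mathbb{R}^D$, $D=MN+2N+1$. For training data $\bm{x}_i\in\mathbb{R}^M$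 with labels $q_i\in\{0,1\}$, $i=1,\dots,I$, put $\bm{y}_i=\bm{W}\bm{h}(\bm{x}_i)$, $z_i=\bm{V}\bm{h}(\bm{f}(\bm{y}_i))$, $p_i=s(z_i)$, where $s(z)=1/(1+e^{-z})$; then $s'(z_i)=p_i(1-p_i)$, $s''(z_i)=(1-2p_i)(1-p_i)p_i$; and $\delta_i=p_i-q_i$. Loss: $L(\bm{\theta})=-\sum_{i=1}^I\big(q_i\log p_i+(1-q_i)\log(1-p_i)\big)$. $\bm{H}_L(\bm{\theta})\in\mathbb{R}^{D\times D}$ is the Hessian of $L$ with respect to $\bm{\theta}$. The gradient of a scalar function is the column vector of its partial derivatives. *)

(* Defs.v *)
From HB Require Import structures.
From mathcomp Require Import all_boot all_order all_algebra.
From mathcomp Require Import all_classical all_reals all_analysis.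
Set Implicit Arguments.
Unset Strict Implicit.
Unset Printing Implicit Defensive.
Import Order.TTheory GRing.Theory Num.Theory.
Import numFieldNormedType.Exports.
Local Open Scope ring_scope.
Local Open Scope classical_set_scope.

Section Calculus.
Context {R : realType}.

Definition basis_cV {n : nat} (k : 'I_n) : 'cV[R]_n := delta_mx k ord0.

(* Like 'D_v itself, gradient and hessian are total: they have their usual
   meaning only where the partial derivatives involved exist. *)
Definition gradient {n : nat} (g : 'cV[R]_n -> R) (t : 'cV[R]_n) : 'cV[R]_n :=
  \col_k 'D_(basis_cV k) g t.

Definition hessian {n : nat} (g : 'cV[R]_n -> R) (t : 'cV[R]_n) : 'M[R]_n :=
  \matrix_(j, k) 'D_(basis_cV j) ('D_(basis_cV k) g) t.

Definition thrice_differentiable (f : R -> R) : Prop :=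
  forall n : nat, (n < 3)%N -> forall y : R, derivable f^`(n) y 1.

Definition sigmoid (z : R) : R := (1 + expR (- z))^-1.

Definition sigmoid' : R -> R := sigmoid^`().

Definition sigmoid'' : R -> R := sigmoid^`(2).

End Calculus.

Section Vectors.
Context {R : realType}.

Definition aug {n : nat} (u : 'cV[R]_n) : 'cV[R]_(1 + n) := col_mx 1%:M u.

Definition sqnorm {n : nat} (u : 'cV[R]_n) : R := (u^T *m u) ord0 ord0.

Definition vact {N : nat} (f : R -> R) (y : 'cV[R]_N) : 'cV[R]_N := map_mx f y.

Definition vact'' {N : nat} (f : R -> R) (y : 'cV[R]_N) : 'cV[R]_N :=
  map_mx f^`(2) y.

Definition vact''0 {N : nat} (f : R -> R) (y : 'cV[R]_N) : 'cV[R]_(1 + N) :=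
  col_mx 0 (vact'' f y).

Definition dact' {N : nat} (f : R -> R) (y : 'cV[R]_N) : 'M[R]_N :=
  diag_mx (map_mx f^`() y)^T.

Definition dact'0 {N : nat} (f : R -> R) (y : 'cV[R]_N) : 'M[R]_(1 + N, N) :=
  col_mx 0 (dact' f y).

End Vectors.

Section Network.
Context {R : realType} {M N : nat}.

(* The dimension (1 + M) * N + (1 + N) equals M N + 2 N + 1. *)
Definition param : Type := 'cV[R]_((1 + M) * N + (1 + N)).

(* mxvec lists a matrix row by row, so mxvec W^T lists W column by column. *)
Definition pack (W : 'M[R]_(N, 1 + M)) (V : 'rV[R]_(1 + N)) : param :=
  col_mx (mxvec W^T)^T V^T.

Definition Wmx (t : param) : 'M[R]_(N, 1 + M) := (vec_mx (usubmx t)^T)^T.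

Definition Vmx (t : param) : 'rV[R]_(1 + N) := (dsubmx t)^T.

Definition Vtilde (t : param) : 'rV[R]_N := rsubmx (Vmx t).

Lemma packK (W : 'M[R]_(N, 1 + M)) (V : 'rV[R]_(1 + N)) :
  Wmx (pack W V) = W /\ Vmx (pack W V) = V.
Proof.
by rewrite /Wmx /Vmx /pack col_mxKu col_mxKd !trmxK mxvecK trmxK.
Qed.

Lemma unpackK (t : param) : pack (Wmx t) (Vmx t) = t.
Proof. by rewrite /pack /Wmx /Vmx !trmxK vec_mxK trmxK vsubmxK. Qed.

Definition preact (t : param) (x : 'cV[R]_M) : 'cV[R]_N := Wmx t *m aug x.

Definition logit (f : R -> R) (t : param) (x : 'cV[R]_M) : R :=
  (Vmx t *m aug (vact f (preact t x))) ord0 ord0.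

Definition prob (f : R -> R) (t : param) (x : 'cV[R]_M) : R :=
  sigmoid (logit f t x).

Definition loss {I : nat} (f : R -> R) (x : 'I_I -> 'cV[R]_M) (q : 'I_I -> R)
    (t : param) : R :=
  - \sum_(i < I) (q i * ln (prob f t (x i))
                  + (1 - q i) * ln (1 - prob f t (x i))).

Definition trace_hessian {I : nat} (f : R -> R) (x : 'I_I -> 'cV[R]_M)
    (q : 'I_I -> R) (t : param) : R :=
  \tr (hessian (loss f x q) t).

Definition grad_v (g : param -> R) (t : param) : 'cV[R]_(1 + N) :=
  dsubmx (gradient g t).

Section Terms.
Context (f : R -> R) (t : param) (x : 'cV[R]_M) (q : R).
Let y := preact t x.
Let z := logit f t x.
Let delta := prob f t x - q.

Definition term1 : 'cV[R]_(1 + N) :=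
  (1 + sqnorm x) *:
  ((sigmoid'' z *: (aug (vact f y) *m Vtilde t *m dact' f y)
    + (2 * sigmoid' z) *: dact'0 f y) *m dact' f y *m (Vtilde t)^T).

Definition term2 : 'cV[R]_(1 + N) :=
  (1 + sqnorm x) *:
  (sigmoid' z *: (aug (vact f y) *m Vtilde t *m vact'' f y)
   + delta *: vact''0 f y).

Definition term3 : 'cV[R]_(1 + N) :=
  (sigmoid'' z * (1 + sqnorm (vact f y))) *: aug (vact f y).

End Terms.

End Network.

Arguments param : clear implicits.

(* Main.v *)
Require Import Defs.
From mathcomp Require Import all_boot all_order all_algebra.
From mathcomp Require Import all_classical all_reals all_analysis.
From mathcomp Require Import ring.
Import Order.TTheory GRing.Theory Num.Theory.
Import numFieldNormedType.Exports.
Local Open Scope ring_scope.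

(* The logit is linear in V and each pre-activation is linear in W, so both the
   first and the pure second partial derivatives of z are explicit. With
   L = sum_i l_i(z_i) and l_i'(z) = s(z) - q_i, the trace of the Hessian is
     sum_i s'(z_i) |grad z_i|^2 + (s(z_i) - q_i) tr(H_{z_i}),
   where |grad z|^2 = 1 + |f(y)|^2 + (1 + |x|^2) sum_n v_n^2 f'(y_n)^2 and
   tr(H_z) = (1 + |x|^2) sum_n v_n f''(y_n), the factor 1 + |x|^2 = |h(x)|^2
   coming from the entries of W. Along a direction of v the pre-activations are
   constant, and differentiating this closed form gives the three terms. *)

(** * Calculus of directional derivatives of real-valued maps *)

Section DirectionalDerivatives.
Context {R : realType} {V : normedModType R}.
Implicit Types (u g : V -> R) (a v : V).

(** Restricting [u] to the line through [a] with direction [v] turns a directional derivative into a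
    one-variable one, so the one-variable chain rule becomes available. *)
Lemma is_derive_line {u a v d} :
  is_derive a v u d <-> is_derive (0 : R) 1 (fun h => u (h *: v + a)) d.
Proof.
(* Both sides are limits of the same difference quotient. *)
have E : 'D_v u a = 'D_1 (fun h : R => u (h *: v + a)) 0.
  rewrite /derive; set g1 := fun h => h^-1 *: _; set g2 := fun h => h^-1 *: _.
  suff -> : g1 = g2 by []; apply/funext => h; rewrite /g1 /g2 /=.
  by rewrite scale0r add0r addr0 [_%:A]mulr1.
split=> -[du De]; split.
- exact: (derivable1P _ _ _).1.
- by rewrite -E.
- exact: (derivable1P _ _ _).2.
- by rewrite E.
Qed.

(** The outer map is scalar, so only the derivative of [u] along the line matters; no total
    differentiability of [u] is asked for. *)
Lemma is_derive_chain {f : R -> R} {u a v df du} :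
  is_derive (u a) 1 f df -> is_derive a v u du ->
  is_derive a v (fun t => f (u t)) (df * du).
Proof.
move=> Df /is_derive_line Du; apply/is_derive_line.
by apply: (@is_derive1_comp _ f) => //; rewrite scale0r add0r.
Qed.

(** Along the line [u] is affine in [h] with slope [u v]. This serves the coordinates of linear maps
    of the parameters. *)
Lemma is_derive_additive u a v :
  (forall h : R, u (h *: v + a) = h * u v + u a) -> is_derive a v u (u v).
Proof.
move=> uE; apply/is_derive_line; under eq_fun do rewrite uE.
have H : is_derive (0 : R) 1 (fun h : R => (u v \*: id) h + cst (u a) h) (u v *: 1 + 0).
  exact: is_deriveD.
by rewrite addr0 [_%:A]mulr1 in H; under eq_fun do rewrite mulrC.
Qed.

Lemma is_derive_add {u g a v du dg} :
  is_derive a v u du -> is_derive a v g dg ->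
  is_derive a v (fun t => u t + g t) (du + dg).
Proof. exact: is_deriveD. Qed.

Lemma is_derive_scale {c : R} {u a v du} :
  is_derive a v u du -> is_derive a v (fun t => c * u t) (c * du).
Proof. exact: is_deriveZ. Qed.

Lemma is_derive_mul {u g a v du dg} :
  is_derive a v u du -> is_derive a v g dg ->
  is_derive a v (fun t => u t * g t) (du * g a + u a * dg).
Proof.
move=> Du Dg; apply: (is_derive_eq (is_deriveM Du Dg)).
by rewrite addrC [_ *: du]mulrC.
Qed.

Lemma is_derive_bigsum {n} {u : 'I_n -> V -> R} {a v} {du : 'I_n -> R} :
  (forall i, is_derive a v (u i) (du i)) ->
  is_derive a v (fun t => \sum_i u i t) (\sum_i du i).
Proof.
move=> Du; have := is_derive_sum Du.
by congr is_derive; apply/funext => t; rewrite fct_sumE.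
Qed.

End DirectionalDerivatives.

(** * The sigmoid and the cross-entropy of a single logit *)

Section Sigmoid.
Context {R : realType}.
Implicit Types (z q : R).

Lemma is_derive_sigmoid z :
  is_derive z 1 (@sigmoid R) (sigmoid z * (1 - sigmoid z)).
Proof.
have pos : 1 + expR (- z) != 0 by rewrite gt_eqF// ltr_pwDl// expR_ge0.
have D : is_derive z 1 (fun w : R => 1 + expR (- w)) (- expR (- z)).
  have De := is_derive_chain (is_derive_expR (- z)) (is_deriveNid z 1).
  apply: (is_derive_eq (is_derive_add (is_derive_cst (1 : R) z 1) De)).
  by rewrite mulrN1 add0r.
have DV := is_deriveV (f := fun w => 1 + expR (- w)) pos D.
suff <- : - (1 + expR (- z)) ^- 2 *: - expR (- z) = sigmoid z * (1 - sigmoid z).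
  exact: DV.
rewrite /sigmoid [LHS]mulrNN; move: pos; move: (expR _) => e pos.
by field.
Qed.

Lemma sigmoid'E z : sigmoid' z = sigmoid z * (1 - sigmoid z).
Proof. by rewrite /sigmoid' derive1E; have [_] := is_derive_sigmoid z. Qed.

Lemma is_derive_sigmoid' z : is_derive z 1 (@sigmoid' R) (sigmoid'' z).
Proof.
have Ds := is_derive_sigmoid z.
have Ds1 := is_derive_add (is_derive_cst (1 : R) z 1) (is_deriveN Ds).
(* Only derivability is kept: the value is [sigmoid''] by definition and is never computed. *)
have [D _] := is_derive_mul Ds Ds1.
suff sE : @sigmoid' R = (fun w => sigmoid w * (1 - sigmoid w)).
  by split; [rewrite sE; exact: D | rewrite -derive1E].
by apply/funext => w; rewrite sigmoid'E.
Qed.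

Lemma sigmoid_gt0 z : 0 < sigmoid z.
Proof. by rewrite invr_gt0 ltr_pwDl// expR_ge0. Qed.

Lemma sigmoid_lt1 z : sigmoid z < 1.
Proof.
by rewrite invf_lt1 ?ltrDl ?expR_gt0// ltr_pwDl// expR_ge0.
Qed.

(** The factor [s (1 - s)] of the sigmoid's derivative cancels the denominators [s] and [1 - s]
    produced by the logarithms; both are positive. *)
Lemma is_derive_cross_entropy q z :
  is_derive z 1
    (fun w => - (q * ln (sigmoid w) + (1 - q) * ln (1 - sigmoid w)))
    (sigmoid z - q).
Proof.
have s0 := sigmoid_gt0 z; have s1 : 0 < 1 - sigmoid z.
  by rewrite subr_gt0 sigmoid_lt1.
have Ds := is_derive_sigmoid z.
have D1 := is_derive_chain (is_derive1_ln s0) Ds.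
have Ds1 := is_derive_add (is_derive_cst (1 : R) z 1) (is_deriveN Ds).
have D2 := is_derive_chain (f := @ln R) (u := fun w => 1 - sigmoid w)
  (is_derive1_ln s1) Ds1.
have := is_deriveN (is_derive_add (is_deriveZ q D1) (is_deriveZ (1 - q) D2)).
move/is_derive_eq; apply; rewrite /GRing.scale/= {D1 D2 Ds Ds1}.
move: (sigmoid z) s0 s1 => s s0 s1.
by field; rewrite !gt_eqF.
Qed.

End Sigmoid.

(** * First and second directional derivatives of the logit *)

Section Logit.
Context {R : realType} {M N : nat} {f : R -> R}.
Context (hf : thrice_differentiable f).
Implicit Types (t e : param R M N) (x : 'cV[R]_M).

Lemma is_derive_iter (n : nat) (y : R) : (n < 3)%N ->
  is_derive y 1 f^`(n)%classic (f^`(n.+1)%classic y).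
Proof.
by move=> n3; split; [exact: hf | rewrite derive1nS derive1E].
Qed.

Lemma preact_lin (h : R) e t x :
  preact (h *: e + t) x = h *: preact e x + preact t x.
Proof. by rewrite /preact /Wmx !linearP/= mulmxDl -scalemxAl. Qed.

Lemma Vmx_lin (h : R) e t : Vmx (h *: e + t) = h *: Vmx e + Vmx t.
Proof. by rewrite /Vmx !linearP. Qed.

Lemma is_derive_preact x n t e :
  is_derive t e (fun t => preact t x n ord0) (preact e x n ord0).
Proof.
by apply: (is_derive_additive (fun t => preact t x n ord0)) => h; rewrite preact_lin !mxE.
Qed.

Lemma is_derive_Vmx k t e :
  is_derive t e (fun t => Vmx t ord0 k) (Vmx e ord0 k).
Proof.
by apply: (is_derive_additive (fun t => Vmx t ord0 k)) => h; rewrite Vmx_lin !mxE.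
Qed.

Lemma VtildeE t n : Vtilde t ord0 n = Vmx t ord0 (rshift 1 n).
Proof. by rewrite mxE. Qed.

Lemma is_derive_Vtilde n t e :
  is_derive t e (fun t => Vtilde t ord0 n) (Vtilde e ord0 n).
Proof. by under eq_fun do rewrite VtildeE; rewrite VtildeE; exact: is_derive_Vmx. Qed.

Lemma is_derive_iter_preact (k : nat) x n t e : (k < 3)%N ->
  is_derive t e (fun t => f^`(k)%classic (preact t x n ord0))
    (f^`(k.+1)%classic (preact t x n ord0) * preact e x n ord0).
Proof.
by move=> k3; exact: (is_derive_chain (is_derive_iter _ _ k3) (is_derive_preact x n t e)).
Qed.

Lemma mul_aug (V : 'rV[R]_(1 + N)) (u : 'cV[R]_N) :
  (V *m aug u) ord0 ord0 =
  V ord0 (lshift N ord0) + \sum_n V ord0 (rshift 1 n) * u n ord0.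
Proof.
rewrite mxE big_split_ord big_ord1 /= col_mxEu mxE mulr1; congr (_ + _).
by apply: eq_bigr => n _; rewrite col_mxEd.
Qed.

Lemma logitE t x : logit f t x =
  Vmx t ord0 (lshift N ord0) + \sum_n Vtilde t ord0 n * f (preact t x n ord0).
Proof.
rewrite /logit mul_aug; congr (_ + _).
by apply: eq_bigr => n _; rewrite VtildeE [vact _ _ _ _]mxE.
Qed.

Definition dlogit x e t : R :=
  Vmx e ord0 (lshift N ord0) +
  \sum_n (Vtilde e ord0 n * f (preact t x n ord0) +
    Vtilde t ord0 n * (f^`()%classic (preact t x n ord0) * preact e x n ord0)).

(** The second derivative of the logit, first along [e'] and then along [e]: two mixed terms pairing
    output weights with pre-activations, and one term in [f'']. *)
Definition d2logit x e e' t : R :=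
  \sum_n (Vtilde e' ord0 n *
            (f^`()%classic (preact t x n ord0) * preact e x n ord0) +
          (Vtilde e ord0 n *
            (f^`()%classic (preact t x n ord0) * preact e' x n ord0) +
          Vtilde t ord0 n *
            (f^`(2)%classic (preact t x n ord0) * preact e x n ord0 *
             preact e' x n ord0))).

Lemma is_derive_logit x t e :
  is_derive t e (fun t => logit f t x) (dlogit x e t).
Proof.
under eq_fun do rewrite logitE.
apply: is_derive_add; first exact: is_derive_Vmx.
apply: is_derive_bigsum => n; apply: is_derive_mul.
  exact: is_derive_Vtilde.
exact: (is_derive_iter_preact 0).
Qed.

Lemma is_derive_dlogit x t e e' :
  is_derive t e (dlogit x e') (d2logit x e e' t).
Proof.
(* The added zero is the derivative of the bias entry of [Vmx e'], which does not depend on [t]. *)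
rewrite -[d2logit _ _ _ _]add0r; apply: is_derive_add.
apply: is_derive_bigsum => n; apply: is_derive_add.
  by apply: is_derive_scale; exact: (is_derive_iter_preact 0).
apply: is_derive_mul; first exact: is_derive_Vtilde.
under eq_fun do rewrite mulrC.
rewrite [_ * preact e' x n ord0]mulrC.
by apply: is_derive_scale; exact: (is_derive_iter_preact 1).
Qed.

Lemma is_derive_prob x t e : is_derive t e (fun t => prob f t x)
  (sigmoid' (logit f t x) * dlogit x e t).
Proof.
rewrite sigmoid'E.
exact: (is_derive_chain (is_derive_sigmoid _) (is_derive_logit x t e)).
Qed.

End Logit.

Arguments dlogit {R M N} f x e t.
Arguments d2logit {R M N} f x e e' t.

(** * Coordinate directions of the parameter space as matrix units *)

Section Basis.
Context {R : realType} {M N : nat}.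

(** Packing flattens the transpose of [W], so the position of [(m, n)] holds entry [(n, m)] of
    [W]. *)
Lemma basis_cV_W (m : 'I_(1 + M)) (n : 'I_N) :
  basis_cV (lshift (1 + N) (mxvec_index m n)) = pack (delta_mx n m) 0 :> param R M N.
Proof.
rewrite /pack trmx_delta mxvec_delta !trmx_delta trmx0.
apply/colP => i; rewrite !mxE eqxx andbT /=.
move: (mxvec_index m n) => k.
case: splitP => j ij; rewrite ?mxE ?eqxx ?andbT; last first.
  by rewrite -val_eqE /= ij gtn_eqF// (leq_trans (ltn_ord k))// leq_addr.
by rewrite -!val_eqE /= ij.
Qed.

Lemma basis_cV_V (k : 'I_(1 + N)) :
  basis_cV (rshift ((1 + M) * N) k) = pack 0 (delta_mx ord0 k) :> param R M N.
Proof.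
rewrite /pack trmx_delta trmx0 linear0 trmx0.
apply/colP => i; rewrite !mxE eqxx andbT /=.
case: splitP => j ij; rewrite ?mxE ?eqxx ?andbT.
  by rewrite -val_eqE /= ij ltn_eqF// (leq_trans (ltn_ord j))// leq_addr.
by rewrite -!val_eqE /= ij eqn_add2l.
Qed.

Lemma big_basis (F : param R M N -> R) :
  \sum_k F (basis_cV k) =
  \sum_m \sum_n F (pack (delta_mx n m) 0) + \sum_k F (pack 0 (delta_mx ord0 k)).
Proof.
rewrite big_split_ord /=; congr (_ + _); last first.
  by apply: eq_bigr => k _; rewrite basis_cV_V.
rewrite pair_bigA /= (reindex _ (curry_mxvec_bij _ _)) /=.
by apply: eq_bigr => -[m n] _; rewrite basis_cV_W.
Qed.

Lemma preact_pack (W : 'M[R]_(N, 1 + M)) (V : 'rV[R]_(1 + N)) x :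
  preact (pack W V) x = W *m aug x.
Proof. by rewrite /preact (packK W V).1. Qed.

Lemma sqnormE n (u : 'cV[R]_n) : sqnorm u = \sum_i u i ord0 ^+ 2.
Proof. by rewrite /sqnorm mxE; apply: eq_bigr => i _; rewrite mxE expr2. Qed.

Lemma sqnorm_aug n (u : 'cV[R]_n) : sqnorm (aug u) = 1 + sqnorm u.
Proof.
rewrite !sqnormE big_split_ord big_ord1 /= col_mxEu mxE expr1n; congr (_ + _).
by apply: eq_bigr => i _; rewrite col_mxEd.
Qed.

Lemma delta_mulmx n p (A : 'M[R]_(n, p)) (m : 'I_N) (k : 'I_n) j i :
  (delta_mx m k *m A) i j = (i == m)%:R * A k j.
Proof.
rewrite mxE (bigD1 k)//= big1 ?addr0 => [|l lk]; rewrite mxE ?eqxx ?andbT//.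
by rewrite (negbTE lk) andbF mul0r.
Qed.

Lemma mx0E m n i j : (0 : 'M[R]_(m, n)) i j = 0.
Proof. by rewrite mxE. Qed.

End Basis.

(** * First and second derivatives of the loss *)

Section Loss.
Context {R : realType} {M N I : nat} {f : R -> R}.
Context (hf : thrice_differentiable f).
Context (x : 'I_I -> 'cV[R]_M) (q : 'I_I -> R).
Implicit Types (t e : param R M N).

Definition dloss e t : R :=
  \sum_i (prob f t (x i) - q i) * dlogit f (x i) e t.

(** The first summand is the Gauss-Newton part of the Hessian, the second carries the curvature of
    the logit. *)
Definition d2loss e e' t : R :=
  \sum_i (sigmoid' (logit f t (x i)) * dlogit f (x i) e t * dlogit f (x i) e' t +
          (prob f t (x i) - q i) * d2logit f (x i) e e' t).

Lemma is_derive_loss t e : is_derive t e (loss f x q) (dloss e t).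
Proof.
under [loss _ _ _]eq_fun do rewrite /loss -sumrN.
apply: is_derive_bigsum => i.
exact: (is_derive_chain (is_derive_cross_entropy _ _) (is_derive_logit hf (x i) t e)).
Qed.

(** An equality of functions, because the Hessian differentiates the first partial derivative
    again. *)
Lemma derive_loss e : 'D_e (loss f x q) = dloss e.
Proof. by apply/funext => t; have [_] := is_derive_loss t e. Qed.

Lemma is_derive_dloss t e e' : is_derive t e (dloss e') (d2loss e e' t).
Proof.
apply: is_derive_bigsum => i; apply: is_derive_mul; last exact: is_derive_dlogit.
apply: (is_derive_eq (is_derive_add (is_derive_prob hf (x i) t e)
  (is_derive_cst (- q i : R) t e))).
by rewrite addr0.
Qed.

Lemma trace_hessian_sum t :
  trace_hessian f x q t = \sum_k d2loss (basis_cV k) (basis_cV k) t.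
Proof.
rewrite /trace_hessian /mxtrace; apply: eq_bigr => k _.
by rewrite mxE derive_loss; have [_] := is_derive_dloss t (basis_cV k) (basis_cV k).
Qed.

End Loss.

(** * The trace contribution of one example and its derivative along the output weights *)

Section Trace.
Context {R : realType} {M N : nat} {f : R -> R}.
Context (hf : thrice_differentiable f).
Context (x : 'cV[R]_M).
Implicit Types (t e : param R M N).

Local Notation ycoord t n := (preact t x n ord0).

Lemma dlogitE e t : dlogit f x e t =
  (Vmx e *m aug (vact f (preact t x))) ord0 ord0 +
  \sum_n Vtilde t ord0 n * (f^`()%classic (ycoord t n) * ycoord e n).
Proof.
rewrite mul_aug /dlogit big_split addrA; congr (_ + _ + _).
by apply: eq_bigr => n _; rewrite VtildeE [vact _ _ _ _]mxE.
Qed.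

Lemma preact_pack0 (V : 'rV[R]_(1 + N)) : preact (pack 0 V : param R M N) x = 0.
Proof. by rewrite preact_pack mul0mx. Qed.

Lemma dlogit_V k t :
  dlogit f x (pack 0 (delta_mx ord0 k)) t =
  aug (vact f (preact t x)) k ord0.
Proof.
rewrite dlogitE (packK _ _).2 delta_mulmx mul1r big1 ?addr0// => n _.
by rewrite preact_pack0 mx0E !mulr0.
Qed.

(** The logit is affine in the output weights when the hidden ones are fixed. *)
Lemma d2logit_V k t :
  d2logit f x (pack 0 (delta_mx ord0 k)) (pack 0 (delta_mx ord0 k)) t = 0.
Proof.
by rewrite /d2logit big1// => n _; rewrite preact_pack0 mx0E !mulr0 !addr0.
Qed.

Lemma dlogit_W m n t :
  dlogit f x (pack (delta_mx n m) 0) t =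
  Vtilde t ord0 n * f^`()%classic (ycoord t n) * aug x m ord0.
Proof.
rewrite dlogitE (packK _ _).2 mul0mx mxE add0r (bigD1 n)//= big1 => [|l ln].
  by rewrite preact_pack delta_mulmx eqxx mul1r addr0 mulrA.
by rewrite preact_pack delta_mulmx (negbTE ln) mul0r !mulr0.
Qed.

Lemma d2logit_W m n t :
  d2logit f x (pack (delta_mx n m) 0) (pack (delta_mx n m) 0) t =
  Vtilde t ord0 n * f^`(2)%classic (ycoord t n) * aug x m ord0 ^+ 2.
Proof.
have V0 l : Vtilde (pack (delta_mx n m) 0 : param R M N) ord0 l = 0.
  by rewrite VtildeE (packK _ _).2 mxE.
rewrite /d2logit (bigD1 n)//= big1 => [|l ln].
  rewrite preact_pack delta_mulmx eqxx V0 !mul0r !add0r addr0 mul1r.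
  by rewrite expr2 !mulrA.
by rewrite preact_pack delta_mulmx (negbTE ln) V0 !(mul0r, mulr0) !addr0.
Qed.

Definition trace_term (q : R) t : R :=
  sigmoid' (logit f t x) *
    (1 + sqnorm (vact f (preact t x)) + (1 + sqnorm x) *
       \sum_n (Vtilde t ord0 n * f^`()%classic (ycoord t n)) ^+ 2) +
  (prob f t x - q) *
    ((1 + sqnorm x) * \sum_n Vtilde t ord0 n * f^`(2)%classic (ycoord t n)).

(** Splitting the basis into hidden and output directions, the squared first derivatives add up to
    the squared norm of the gradient of the logit, and the pure second ones to the trace of its
    Hessian. *)
Lemma trace_termE q t :
  \sum_k (sigmoid' (logit f t x) * dlogit f x (basis_cV k) t *
            dlogit f x (basis_cV k) t +
          (prob f t x - q) * d2logit f x (basis_cV k) (basis_cV k) t) =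
  trace_term q t.
Proof.
rewrite big_split /trace_term; congr (_ + _).
  under eq_bigr do rewrite -mulrA -expr2.
  rewrite -mulr_sumr; congr (_ * _).
  rewrite (big_basis (fun e => dlogit f x e t ^+ 2)) addrC; congr (_ + _).
    by under eq_bigr do rewrite dlogit_V; rewrite -sqnorm_aug sqnormE.
  under eq_bigr => m _ do
    (under eq_bigr => n _ do rewrite dlogit_W exprMn mulrC; rewrite -mulr_sumr).
  by rewrite -mulr_suml -sqnorm_aug sqnormE.
rewrite -mulr_sumr; congr (_ * _).
rewrite (big_basis (fun e => d2logit f x e e t)).
(* Only the hidden directions contribute curvature. *)
rewrite [X in _ + X]big1 => [|k _]; last exact: d2logit_V.
rewrite addr0.
under eq_bigr => m _ do
  (under eq_bigr => n _ do rewrite d2logit_W mulrC; rewrite -mulr_sumr).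
by rewrite -mulr_suml -sqnorm_aug sqnormE.
Qed.

Lemma dact'_mulmx p (y : 'cV[R]_N) (A : 'M[R]_(N, p)) n j :
  (dact' f y *m A) n j = f^`()%classic (y n ord0) * A n j.
Proof. by rewrite mul_diag_mx !mxE. Qed.

(** The bias direction has no component in [Vtilde]; this is where the prepended zeros of [dact'0]
    and [vact''0] come from. *)
Lemma sum_Vtilde_delta k (u : 'cV[R]_N) :
  \sum_n Vtilde (pack 0 (delta_mx ord0 k) : param R M N) ord0 n * u n ord0 =
  (col_mx 0 u : 'cV_(1 + N)) k ord0.
Proof.
have <- : (delta_mx (ord0 : 'I_1) k *m (col_mx 0 u : 'cV_(1 + N))) ord0 ord0 =
  (col_mx 0 u : 'cV_(1 + N)) k ord0 by rewrite delta_mulmx mul1r.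
rewrite mxE big_split_ord big_ord1 /= col_mxEu [X in _ * X]mxE mulr0 add0r.
by apply: eq_bigr => n _; rewrite VtildeE (packK _ _).2 col_mxEd.
Qed.

(** Pre-activations do not move with the output weights. For [i = 2] the chain rule uses the third
    derivative of [f], which is then multiplied by zero. *)
Lemma is_derive_iter_preact_V (i : nat) k n t : (i < 3)%N ->
  is_derive t (pack 0 (delta_mx ord0 k))
    (fun t => f^`(i)%classic (ycoord t n)) 0.
Proof.
move=> i3.
have := is_derive_iter_preact hf i x n t (pack 0 (delta_mx ord0 k)) i3.
by rewrite preact_pack0 mx0E mulr0.
Qed.

Lemma is_derive_trace_term q k t :
  is_derive t (pack 0 (delta_mx ord0 k)) (trace_term q)
    ((term1 f t x + term2 f t x q + term3 f t x) k ord0).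
Proof.
set e := pack _ _.
pose a := aug (vact f (preact t x)) k ord0.
pose f1 n := f^`()%classic (ycoord t n); pose f2 n := f^`(2)%classic (ycoord t n).
pose V n := Vtilde t ord0 n; pose Ve n := Vtilde e ord0 n.
have Dz : is_derive t e (fun t => logit f t x) a.
  by rewrite /a -dlogit_V; exact: is_derive_logit.
have Ds : is_derive t e (fun t => sigmoid' (logit f t x)) (sigmoid'' (logit f t x) * a).
  exact: (is_derive_chain (is_derive_sigmoid' _) Dz).
have Dp : is_derive t e (fun t => prob f t x - q) (sigmoid' (logit f t x) * a + 0).
  by apply: is_derive_add; rewrite /a -dlogit_V; exact: is_derive_prob.
have D1 n : is_derive t e (fun t => f^`()%classic (ycoord t n)) 0.
  exact: (is_derive_iter_preact_V 1 k n t).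
have D2 n : is_derive t e (fun t => f^`(2)%classic (ycoord t n)) 0.
  exact: is_derive_iter_preact_V.
have DV n : is_derive t e (fun t => Vtilde t ord0 n) (Ve n).
  exact: is_derive_Vtilde.
have Df : is_derive t e (fun t => sqnorm (vact f (preact t x))) 0.
  under eq_fun do rewrite sqnormE; under eq_fun do under eq_bigr do rewrite mxE expr2.
  have D0 n : is_derive t e (fun t => f (ycoord t n)) 0.
    exact: (is_derive_iter_preact_V 0 k n t).
  apply: (is_derive_eq (is_derive_bigsum (fun n => is_derive_mul (D0 n) (D0 n)))).
  by rewrite big1 // => n _; rewrite mul0r mulr0 addr0.
have DS1 : is_derive t e
    (fun t => \sum_n (Vtilde t ord0 n * f^`()%classic (ycoord t n)) ^+ 2)
    (2 * \sum_n Ve n * (f1 n * (f1 n * V n))).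
  under eq_fun do under eq_bigr do rewrite expr2.
  have DM n := is_derive_mul (DV n) (D1 n).
  apply: (is_derive_eq (is_derive_bigsum (fun n => is_derive_mul (DM n) (DM n)))).
  rewrite mulr_sumr; apply: eq_bigr => n _; rewrite -/(f1 n) -/(V n).
  by ring.
have DS2 : is_derive t e
    (fun t => \sum_n Vtilde t ord0 n * f^`(2)%classic (ycoord t n))
    (\sum_n Ve n * f2 n).
  apply: (is_derive_eq (is_derive_bigsum (fun n => is_derive_mul (DV n) (D2 n)))).
  by apply: eq_bigr => n _; rewrite mulr0 addr0.
have DA := is_derive_add (is_derive_add (is_derive_cst (1 : R) t e) Df)
  (is_derive_scale (c := 1 + sqnorm x) DS1).
have DB := is_derive_mul Dp (is_derive_scale (c := 1 + sqnorm x) DS2).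
(* Differentiating [sigmoid'] against [1 + sqnorm (vact f _)] gives [term3]; the rest of the first
   product gives [term1], and [DB] gives [term2]. *)
apply: (is_derive_eq (is_derive_add (is_derive_mul Ds DA) DB)).
(* [E1] to [E4] identify the coordinate sums with entries of the matrix products in the three
   terms. *)
have E1 : \sum_n Ve n * (f1 n * (f1 n * V n)) =
    (dact'0 f (preact t x) *m (dact' f (preact t x) *m (Vtilde t)^T)) k ord0.
  have -> : dact'0 f (preact t x) *m (dact' f (preact t x) *m (Vtilde t)^T) =
      col_mx 0 (\col_n (f1 n * (f1 n * V n))).
    rewrite mul_col_mx mul0mx; congr col_mx; apply/colP => n.
    by rewrite !dact'_mulmx [RHS]mxE [_^T _ _]mxE.
  by rewrite -sum_Vtilde_delta; apply: eq_bigr => n _; rewrite [X in _ = _ * X]mxE.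
have E2 : \sum_n Ve n * f2 n = vact''0 f (preact t x) k ord0.
  by rewrite -sum_Vtilde_delta; apply: eq_bigr => n _; rewrite [X in _ = _ * X]mxE.
have E3 : \sum_n (V n * f1 n) ^+ 2 =
    (Vtilde t *m (dact' f (preact t x) *m
      (dact' f (preact t x) *m (Vtilde t)^T))) ord0 ord0.
  rewrite [RHS]mxE; apply: eq_bigr => n _.
  by rewrite !dact'_mulmx [_^T _ _]mxE -/(f1 n) -/(V n); ring.
have E4 : \sum_n V n * f2 n = (Vtilde t *m vact'' f (preact t x)) ord0 ord0.
  by rewrite mxE; apply: eq_bigr => n _; rewrite [vact'' _ _ _ _]mxE.
rewrite -/V in E3 E4 *.
rewrite {}E1 {}E2 {}E3 {}E4.
rewrite /term1 /term2 /term3 !mulmxDl -!scalemxAl -!mulmxA.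
set F := dact' f (preact t x) *m (Vtilde t)^T.
(* These products are 1 by 1 matrices; read as scalars they merely rescale [aug], and the goal
   becomes a ring identity between entries. *)
rewrite [Vtilde t *m (_ *m F)]mx11_scalar [Vtilde t *m vact'' _ _]mx11_scalar.
rewrite !mul_mx_scalar.
rewrite /a; move: (aug _) (vact''0 _ _) (dact'0 _ _ *m F) => h g P.
move: ((Vtilde t *m (_ *m F)) ord0 ord0) ((Vtilde t *m vact'' _ _) ord0 ord0) => s1 s2.
rewrite !mxE /=; ring.
Qed.

End Trace.

Arguments trace_term {R M N} f x q t.

(** * Summation over the training examples *)

Theorem theorem3 (R : realType) (M N I : nat)
    (hM : (1 <= M)%N) (hN : (1 <= N)%N) (hI : (1 <= I)%N)
    (f : R -> R) (hf : thrice_differentiable f)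
    (x : 'I_I -> 'cV[R]_M) (q : 'I_I -> R)
    (hq : forall i, q i = 0 \/ q i = 1)
    (theta : param R M N) :
  [/\ forall k, derivable (loss f x q) theta (basis_cV k),
      forall j k,
        derivable ('D_(basis_cV k) (loss f x q)) theta (basis_cV j),
      forall k : 'I_(1 + N),
        derivable (trace_hessian f x q) theta
          (basis_cV (rshift ((1 + M) * N)%N k))
    & grad_v (trace_hessian f x q) theta =
      \sum_(i < I) (term1 f theta (x i) + term2 f theta (x i) (q i)
                    + term3 f theta (x i))].
Proof.
have Dtrace (k : 'I_(1 + N)) :
    is_derive theta (basis_cV (rshift ((1 + M) * N)%N k)) (trace_hessian f x q)
      ((\sum_(i < I) (term1 f theta (x i) + term2 f theta (x i) (q i)
                      + term3 f theta (x i))) k ord0).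
  have -> : trace_hessian f x q =
      (fun t : param R M N => \sum_i trace_term f (x i) (q i) t).
    (* Exchanging the sums over parameters and examples isolates the trace contribution of each
       example. *)
    apply/funext => t; rewrite (trace_hessian_sum hf) exchange_big.
    by apply: eq_bigr => i _; exact: trace_termE.
  rewrite basis_cV_V summxE; apply: is_derive_bigsum => i.
  exact: is_derive_trace_term.
split.
- by move=> k; have [] := is_derive_loss hf x q theta (basis_cV k).
- move=> j k; rewrite (derive_loss hf).
  by have [] := is_derive_dloss hf x q theta (basis_cV j) (basis_cV k).
- by move=> k; have [] := Dtrace k.
- apply/colP => k; rewrite -[RHS](derive_val (is_derive := Dtrace k)).
  by rewrite !mxE.
Qed.
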